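(* Let $k$ be a field of characteristic $0$ and let $\Phi(X_0,X_1)=\sum_{W\in\{X_0,X_1\}^*}Z_W W\in k\langle\langle X_0,X_1\rangle\rangle$ be a group-like element whose coefficients in degree $1$ are zero. Then the relation $$\Phi(X_0,X_1)\,\Phi(X_1,X_0)=1$$ is equivalent to the family of relations $$\forall\, W\in\{X_0,X_1\}^*\setminus\{\emptyset\},\qquad \sum_{\substack{U_1,U_2\in\{X_0,X_1\}^*\\ U_1U_2=W}} Z_{U_1}Z_{\theta(U_2)}=0 .$$
   Context: $k\langle\langle X_0,X_1\rangle\rangle$ is the ring of formal power series in two non-commutative variables; $\{X_0,X_1\}^*$ is the set of words in $X_0,X_1$ (including the empty word $\emptyset$, identified with $1$). The coproduct $\Delta$ is the (continuous) algebra morphism with $\Delta(X_i)=X_i\otimes 1+1\otimes X_i$ for $i=0,1$, and $\Phi$ is group-like if $\Delta(\Phi)=\Phi\hat\otimes\Phi$; in particular $Z_\emptyset=1$. $\Phi(X_1,X_0)$ is obtained from $\Phi(X_0,X_1)$ by exchanging the variables. $\theta$ is the automorphism of $k\langle\langle X_0,X_1\rangle\rangle$ exchanging $X_0$ and $X_1$; it maps words to words. In the sum, $U_1,U_2$ may be empty. *)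

(* Defs.v *)
From mathcomp Require Import all_boot all_order all_algebra.

Set Implicit Arguments.
Unset Strict Implicit.
Unset Printing Implicit Defensive.

Import GRing.Theory.
Local Open Scope ring_scope.

(* The letter X_0 is [false] and X_1 is [true]; the empty word is [::] and     *)
(* concatenation is [++].                                                     *)
Definition word := seq bool.

Definition splits (w : word) : seq (word * word) :=
  [seq (take i w, drop i w) | i <- iota 0 (size w).+1].

(* [splits w] lists the pairs (u1, u2) with u1 ++ u2 = w, each exactly once.  *)
Lemma mem_splits (w : word) (u : word * word) :
  (u \in splits w) = (u.1 ++ u.2 == w).
Proof.
apply/mapP/eqP => [[i _ ->] /=|<-]; first exact: cat_take_drop.
exists (size u.1); first by rewrite mem_iota size_cat add0n /= ltnS leq_addr.
by rewrite take_size_cat // drop_size_cat //; case: u.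
Qed.

Lemma splits_uniq (w : word) : uniq (splits w).
Proof.
rewrite map_inj_in_uniq ?iota_uniq // => i j.
rewrite !mem_iota !add0n !ltnS /= => le_i le_j [/(congr1 size) + _].
by rewrite !size_takel.
Qed.

(* The automorphism theta on words. *)
Definition theta (w : word) : word := map negb w.

(* k<<X_0, X_1>>: the series f is the formal sum of the (f w) w.  Series are  *)
(* functions and are compared with the pointwise equality [=1].               *)
Definition ncseries (k : fieldType) := word -> k.

(* The completed tensor square of k<<X_0, X_1>>: F is the formal sum of the   *)
(* F (u, v) times (u (x) v), over all pairs of words.                         *)
Definition ncseries2 (k : fieldType) := word * word -> k.

Section Series.
Variable k : fieldType.
Implicit Types (f g : ncseries k) (F G : ncseries2 k) (w : word) (i : bool).

Definition ncmonom w : ncseries k := fun v => (v == w)%:R.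

Definition ncone : ncseries k := ncmonom [::].

Definition ncvar i : ncseries k := ncmonom [:: i].

Definition ncmul f g : ncseries k :=
  fun w => \sum_(u <- splits w) f u.1 * g u.2.

Definition tensor f g : ncseries2 k := fun p => f p.1 * g p.2.

Definition tensor_add F G : ncseries2 k := fun p => F p + G p.

(* (u (x) v)(u' (x) v') = uu' (x) vv', extended bilinearly and continuously.  *)
Definition tensor_mul F G : ncseries2 k :=
  fun p => \sum_(a <- splits p.1) \sum_(b <- splits p.2)
             F (a.1, b.1) * G (a.2, b.2).

Definition Delta_var i : ncseries2 k :=
  tensor_add (tensor (ncvar i) ncone) (tensor ncone (ncvar i)).

Definition Delta_word w : ncseries2 k :=
  foldr (fun i => tensor_mul (Delta_var i)) (tensor ncone ncone) w.

(* The continuous linear extension of [Delta_word].  The image of w is        *)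
(* homogeneous of degree [size w] ([Delta_word_homog]), so only the finitely  *)
(* many words of length [size p.1 + size p.2] contribute to the coefficient   *)
(* at p of the sum of the (f w) Delta(w).                                     *)
Definition Delta f : ncseries2 k :=
  fun p => \sum_(w : (size p.1 + size p.2).-tuple bool) f w * Delta_word w p.

(* The normalisation excludes f = 0, which also satisfies the equation.       *)
Definition group_like f : Prop :=
  f [::] = 1 /\ Delta f =1 tensor f f.

(* The word w evaluated at (X_1, X_0).                                        *)
Definition exchange_word w : ncseries k :=
  foldr (fun i => ncmul (ncvar (~~ i))) ncone w.

(* f(X_1, X_0), the sum of the (f w) w(X_1, X_0); it is cut to the degree of  *)
(* the coefficient in the same way as in [Delta].                             *)
Definition exchange f : ncseries k :=
  fun v => \sum_(w : (size v).-tuple bool) f w * exchange_word w v.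

Lemma Delta_word_homog w (p : word * word) :
  size w != (size p.1 + size p.2)%N -> Delta_word w p = 0.
Proof.
elim: w p => [|i w IHw] [u v] /=.
  by rewrite /tensor /ncone /ncmonom; case: u v => [|? ?] [|? ?] //=;
     rewrite ?mul0r ?mulr0.
move=> ne_size; rewrite /tensor_mul big_seq big1 // => a.
rewrite mem_splits /= => /eqP eq_u; rewrite big_seq big1 // => b.
rewrite mem_splits /= => /eqP eq_v.
move: ne_size; rewrite -eq_u -eq_v !size_cat.
case: a b {eq_u eq_v u v} => [a1 a2] [b1 b2] /= ne_size.
have [eq_w|ne_w] := eqVneq (size w) (size a2 + size b2)%N; last first.
  by rewrite IHw ?mulr0.
suff -> : Delta_var i (a1, b1) = 0 by rewrite mul0r.
have {ne_size} : (size a1 + size b1 != 1)%N.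
  by apply: contraNneq ne_size => eq1; rewrite eq_w addnACA eq1.
rewrite /Delta_var /tensor_add /tensor /ncone /ncvar /ncmonom /=.
by case: a1 b1 => [|? [|? ?]] [|? [|? ?]] //= _;
   rewrite ?eqseq_cons ?andbF ?mul0r ?mulr0 ?addr0.
Qed.

Lemma exchange_wordE w : exchange_word w =1 ncmonom (theta w).
Proof.
elim: w => [|i w IHw] v //=; rewrite /ncmul.
have ncvarE a : ncvar (~~ i) a = (a == [:: ~~ i])%:R by [].
have [->|ne_v] := eqVneq v (~~ i :: theta w).
  rewrite (bigD1_seq ([:: ~~ i], theta w)) ?mem_splits ?splits_uniq //=.
  rewrite ncvarE eqxx mul1r IHw /ncmonom !eqxx big_seq_cond big1 ?addr0 //.
  move=> [a b] /andP[]; rewrite mem_splits ncvarE /= => /eqP eq_ab ne_ab.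
  case: eqP => [eq_a|_]; last by rewrite mul0r.
  by move: eq_ab ne_ab; rewrite eq_a => -[->]; rewrite eqxx.
rewrite /ncmonom (negPf ne_v) big_seq big1 // => -[a b].
rewrite mem_splits ncvarE IHw /ncmonom /= => /eqP eq_ab.
case: eqP => [eq_a|_]; last by rewrite mul0r.
case: eqP => [eq_b|_]; last by rewrite mulr0.
by move: ne_v; rewrite -eq_ab eq_a eq_b eqxx.
Qed.

End Series.

Arguments ncone {k}.

(* Main.v *)
Require Import Defs.
From mathcomp Require Import all_boot all_order all_algebra.

Set Implicit Arguments.
Unset Strict Implicit.
Unset Printing Implicit Defensive.

Import GRing.Theory.
Local Open Scope ring_scope.

(** The coefficient of a word v in f(X_1, X_0) is f (theta v), because theta
    permutes the words and is its own inverse ([exchangeE]).  Hence the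
    coefficient of W in Phi(X_0, X_1) Phi(X_1, X_0) is exactly the left-hand
    side of the relation attached to W, and the two conditions agree word by
    word for W nonempty.  The remaining coefficient, at the empty word, is
    Z_[::] ^ 2, which is 1 because the constant term of a group-like series
    is 1, as the product equation requires there. *)

Lemma thetaK : involutive theta.
Proof. exact: mapK negbK. Qed.

(** Only the word theta v is sent to v by the exchange of variables, so the sum
    defining the coefficient at v has a single nonzero term. *)
Lemma exchangeE (k : fieldType) (f : ncseries k) (v : word) :
  exchange f v = f (theta v).
Proof.
have size_theta : size (theta v) == size v by rewrite size_map.
rewrite /exchange (bigD1 (Tuple size_theta)) //= exchange_wordE /ncmonom thetaK.
rewrite eqxx mulr1 big1 ?addr0 // => w ne_w.
rewrite exchange_wordE /ncmonom; case: eqP => [eq_v|_]; last by rewrite mulr0.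
by case/eqP: ne_w; apply: val_inj; rewrite /= -[LHS]thetaK -eq_v.
Qed.

Lemma ncmul_exchange (k : fieldType) (f : ncseries k) (w : word) :
  ncmul f (exchange f) w = \sum_(u <- splits w) f u.1 * f (theta u.2).
Proof. by apply: eq_bigr => u _; rewrite exchangeE. Qed.

Theorem theorem2p4 (k : fieldType) (char_k : [pchar k] =i pred0)
    (Z : ncseries k) (Z_gl : group_like Z)
    (Z_deg1 : forall i : bool, Z [:: i] = 0) :
  ncmul Z (exchange Z) =1 ncone
  <->
  (forall W : word, W != [::] ->
     \sum_(U <- splits W) Z U.1 * Z (theta U.2) = 0).
Proof.
have [Z_nil _] := Z_gl; split=> [inv_Z W ne_W|rel_Z W].
  by rewrite -ncmul_exchange inv_Z /ncone /ncmonom (negPf ne_W).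
rewrite ncmul_exchange /ncone /ncmonom; have [->|ne_W] := eqVneq W [::].
  by rewrite /splits /= big_seq1 /= Z_nil mulr1.
exact: rel_Z.
Qed.
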